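(* Let $\psi(k)=q^2+\cdots+q^{k+1}$ for $k\ge 1$ and let $(b_j^k)_{1\le k\le j}$ be the unique family of polynomials in the variable $q$ satisfying the initial conditions $$b_j^j=1\ \text{ for } j\ge 1,\qquad b_j^1=(1-q^2)\cdots(1-q^j)\ \text{ for } j\ge 2,$$ and the recurrence relation $$b_j^k=b_{j-1}^{k-1}+(1-q^j)\,b_{j-1}^k-b_{j-2}^{k-1}\qquad(2\le k\le j-1).$$ Then, for $1\le k\le j-1$, $$b_j^k=\sum_{t=1}^{k}(1-\psi(t))\,b(j,k,t),$$ where $b(j,k,k)=\Pi(k+2,j)$ and, for $1\le t<k\le j-1$, $$b(j,k,t)=\sum_{u=1}^{\min\{j-k-1,\,k-t\}}\ \sum_{d_1+\cdots+d_u=k-t}\Sigma\Pi(t+2,j)[d_1+1,\dots,d_u+1],$$ the indices $d_1,\dots,d_u$ being positive integers.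
   Context: Superscripts in $b_j^k$ are indices, not exponents. Define $\Pi(u,v)=\prod_{t=u}^{v}(1-q^t)$ for $1\le u\le v$ and $\Pi(u,v)=1$ for $u>v$. Let $s_1,\dots,s_p\ge 2$ be integers and let $i_1,\dots,i_p$ be integers with $u\le i_1$, $i_t+s_t\le i_{t+1}$ for $1\le t\le p-1$, and $i_p+s_p-1\le v$. Then $\Pi(u,v)[i_1(s_1),\dots,i_p(s_p)]$ denotes the polynomial obtained from the product $\Pi(u,v)$ by replacing, for each $t=1,\dots,p$, the subproduct of $s_t$ consecutive factors $(1-q^{i_t})(1-q^{i_t+1})\cdots(1-q^{i_t+s_t-1})$ by the monomial $-q^{i_t}$. For example $\Pi(4,10)[5(3),8(2)]=(1-q^4)(-q^5)(-q^8)(1-q^{10})$. For integers $l_1,\dots,l_u\ge 2$ and $a\le b$, $$\Sigma\Pi(a,b)[l_1,\dots,l_u]=\sum_{(i_1,\dots,i_u)\in I}\Pi(a,b)[i_1(l_1),\dots,i_u(l_u)],$$ where $I=\{(i_1,\dots,i_u): a\le i_1,\ i_t+l_t\le i_{t+1}\text{ for }1\le t<u,\ i_u+l_u-1\le b\}$; its value is $0$ if $I$ is empty. Empty sums are $0$. *)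

(* Defs.v *)
From mathcomp Require Import all_boot all_algebra.

Set Implicit Arguments.
Unset Strict Implicit.
Unset Printing Implicit Defensive.

Import GRing.Theory.
Local Open Scope ring_scope.

(* The variable q is 'X : {poly int}.  Superscripts of b_j^k are indices:
   b_j^k is written b j k. *)

Definition Pi (u v : nat) : {poly int} := \prod_(u <= t < v.+1) (1 - 'X^t).

(* Pi(a,b)[i_1(l_1),...,i_p(l_p)]: the factors 1 - q^x whose index x lies in
   one of the blocks i_t, ..., i_t + l_t - 1 are deleted, and one monomial
   - q^(i_t) is inserted for each block.  Meaningful under [admissible]. *)
Definition PiRepl (a b p : nat) (i l : 'I_p -> nat) : {poly int} :=
  (\prod_(a <= x < b.+1 | [forall t : 'I_p, ~~ (i t <= x < i t + l t)%N])
      (1 - 'X^x))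
  * \prod_(t < p) (- 'X^(i t)).

Definition admissible (a b p : nat) (i l : 'I_p -> nat) : bool :=
  [&& [forall t : 'I_p, (t == 0 :> nat) ==> (a <= i t)%N],
      [forall t : 'I_p, forall t' : 'I_p,
         (t' == t.+1 :> nat) ==> (i t + l t <= i t')%N]
    & [forall t : 'I_p, (t.+1 == p) ==> (i t + l t - 1 <= b)%N]].

(* For block lengths >= 1, an admissible tuple has all its entries <= b, so
   that ranging over 'I_b.+1 loses nothing. *)
Definition SigmaPi (a b p : nat) (l : 'I_p -> nat) : {poly int} :=
  \sum_(i : {ffun 'I_p -> 'I_b.+1} | admissible a b (fun t => i t) l)
     PiRepl a b (fun t => i t) l.

Definition psi (k : nat) : {poly int} := \sum_(2 <= i < k.+2) 'X^i.

(* b(j,k,t) for 1 <= t <= k <= j - 1; positive integers d_1, ..., d_u of sum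
   k - t are all <= k - t, hence the finite range. *)
Definition bcoef (j k t : nat) : {poly int} :=
  if t == k then Pi k.+2 j
  else \sum_(1 <= u < (minn (j - k - 1) (k - t)).+1)
         \sum_(d : {ffun 'I_u -> 'I_(k - t).+1}
               | [forall r, 0 < d r]%N && (\sum_r d r == k - t)%N)
            SigmaPi t.+2 j (fun r => (d r).+1).

Definition is_b_family (b : nat -> nat -> {poly int}) : Prop :=
  [/\ forall j, (1 <= j)%N -> b j j = 1,
      forall j, (2 <= j)%N -> b j 1%N = \prod_(2 <= t < j.+1) (1 - 'X^t)
    & forall j k, (2 <= k <= j - 1)%N ->
        b j k = b (j - 1)%N (k - 1)%N + (1 - 'X^j) * b (j - 1)%N k
                - b (j - 2)%N (k - 1)%N].

Lemma b_family_exists : exists b, is_b_family b.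
Proof.
pose step (j k : nat) (x y z : {poly int}) : {poly int} :=
  if j == k then 1 else
  if k == 1%N then \prod_(2 <= t < j.+1) (1 - 'X^t)
  else x + (1 - 'X^j) * y - z.
pose b := fix b (j : nat) : nat -> {poly int} := fun k =>
  if j is j1.+1 then
    step j k (b j1 k.-1) (b j1 k) (if j1 is j2.+1 then b j2 k.-1 else 0)
  else 0.
have bE j k : b j.+2 k = step j.+2 k (b j.+1 k.-1) (b j.+1 k) (b j k.-1) by [].
have b1E k : b 1%N k = step 1%N k (b 0%N k.-1) (b 0%N k) 0 by [].
have stepE j x y z : step j j x y z = 1 by rewrite /step eqxx.
move: b bE b1E => b bE b1E; exists b; split=> [j j0|j j2|j k /andP[k2 kj]].
- by case: j j0 => [//|[|j]] _; rewrite ?bE ?b1E stepE.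
- by case: j j2 => [//|[//|j]] _; rewrite bE /step.
case: j kj => [|[|j]] kj; [by case: k k2 kj|by case: k k2 kj|].
rewrite !subn1 subn2 bE /step gtn_eqF; first by rewrite gtn_eqF.
by move: kj; rewrite subn1.
Qed.

Lemma b_family_unique b c : is_b_family b -> is_b_family c ->
  forall j k, (1 <= k <= j)%N -> b j k = c j k.
Proof.
move=> [b0 b1 bS] [c0 c1 cS] j; have [n] := ubnP j.
elim: n j => // n IH j ltjn k /andP[k0 kj].
have [->|nkj] := eqVneq k j; first by rewrite b0 ?c0 //; apply: leq_trans kj.
have ltkj : (k < j)%N by rewrite ltn_neqAle nkj.
have [k1|nk1] := eqVneq k 1%N; first by rewrite k1 in ltkj *; rewrite b1 ?c1.
have k2 : (1 < k)%N by rewrite ltn_neqAle eq_sym nk1.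
have kj1 : (k <= j - 1)%N by rewrite leq_subRL ?add1n // (leq_trans k0).
have j0 : (0 < j)%N by apply: leq_trans kj.
have lt1 : (j - 1 < n)%N by rewrite subn1 prednK.
have lt2 : (j - 2 < n)%N by apply: leq_ltn_trans lt1; apply: leq_sub2l.
have k10 : (0 < k - 1)%N by rewrite subn_gt0.
rewrite bS ?k2 // cS ?k2 // (IH _ lt1 k) ?k0 // (IH _ lt1) ?k10 ?leq_sub2r //.
by rewrite (IH _ lt2) // k10 (leq_trans (leq_sub2r 1 kj1)) // -subnDA.
Qed.

(* Main.v *)
Require Import Defs.
From mathcomp Require Import all_boot all_algebra.
From mathcomp Require Import zify ring.

Import GRing.Theory.
Local Open Scope ring_scope.

(** By uniqueness of the family, it suffices that the right-hand side, completed
by the value 1 on the diagonal, satisfies the defining relations.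

The double sum defining b(j,k,t) says: place any number of disjoint blocks in
the interval t+2, ..., j, with lengths at least 2 and with total excess k - t,
the excess of a block of length l being l - 1.  A factor 1 - q^x is paid for
each uncovered x and a factor - q^i for each block starting at i.  Write
S(c,m) for the sum over all placements of total excess m in the half-open
interval [a,c), the lower end a being kept fixed; then
b(j,k,t) = S(j+1,k-t) for a = t+2 ([bcoefE]).

Whether the top point c of [a,c+1) is uncovered, or is the end of a block of
excess e, gives ([block_total_step])
  S(c+1,m) = (1 - q^c) S(c,m) - sum_(e >= 1) q^(c-e) S(c-e,m-e).
The sum over e at (c+1,m+1), deprived of its first term q^c S(c,m), is the sum
over e at (c,m).  Eliminating it leaves ([block_total_three_term])
  S(c+2,m+1) = S(c+1,m) + (1 - q^(c+1)) S(c+1,m+1) - S(c,m),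
which is the recurrence of the b_j^k.  As 1 - psi(t) and t + 2 do not
involve j and k, the recurrence passes to the sum over t; in the extra term
t = k the excess is 0 and S is a plain product.  The three-term relation needs
a <= c, which fails exactly when k = j - 1: there every term with t < k
vanishes for lack of room, and the formula reads 1 - psi(j-1)
([b_formula_subdiag]). *)

Set Implicit Arguments.
Unset Strict Implicit.
Unset Printing Implicit Defensive.

(** * Sums over finite functions, by their last value *)

Lemma big_nat_widen_ord (V : nmodType) (N a n : nat) (F : nat -> V) : (n <= N)%N ->
  \sum_(a <= x < n) F x =
  \sum_(x < N) if ((a <= x) && (x < n))%N then F x else 0.
Proof.
move=> nN; rewrite big_geq_mkord (big_ord_widen_cond N (fun x => true && (a <= x)%N) F nN).
by rewrite big_mkcond.
Qed.

Definition ffun_rcons (T : Type) (n : nat) (f : {ffun 'I_n -> T}) (x : T) :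
    {ffun 'I_n.+1 -> T} :=
  [ffun t => if unlift ord_max t is Some s then f s else x].

Lemma ffun_rcons_lift (T : Type) n (f : {ffun 'I_n -> T}) x s :
  ffun_rcons f x (lift ord_max s) = f s.
Proof. by rewrite ffunE liftK. Qed.

Lemma ffun_rcons_max (T : Type) n (f : {ffun 'I_n -> T}) x :
  ffun_rcons f x ord_max = x.
Proof. by rewrite ffunE unlift_none. Qed.

Lemma sum_ffun_recr (V : nmodType) (T : finType) n
    (P : pred {ffun 'I_n.+1 -> T}) (F : {ffun 'I_n.+1 -> T} -> V) :
  \sum_(f | P f) F f =
  \sum_(x : T) \sum_(g | P (ffun_rcons g x)) F (ffun_rcons g x).
Proof.
rewrite pair_big_dep /= (reindex (fun y => ffun_rcons y.2 y.1)) //=.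
exists (fun f => (f ord_max, [ffun s => f (lift ord_max s)])) => [[x g] _|f _] /=.
  congr (_, _); first exact: ffun_rcons_max.
  by apply/ffunP=> s; rewrite ffunE ffun_rcons_lift.
apply/ffunP=> t; rewrite ffunE; case: unliftP => [s ->|->] //.
by rewrite ffunE.
Qed.

Lemma sum_ffun_ord0 (V : nmodType) (T : finType)
    (P : pred {ffun 'I_0 -> T}) (F : {ffun 'I_0 -> T} -> V) (p : bool) (v : V) :
    (forall f, P f = p) -> (forall f, F f = v) -> \sum_(f | P f) F f = if p then v else 0.
Proof.
move=> Pp Fv; rewrite (eq_bigl (fun=> p)) //; case: p {Pp}; last by rewrite big_pred0.
rewrite (big_pred1 (ffun0 (card_ord 0))) ?Fv // => f /=.
by symmetry; apply/eqP/ffunP => -[].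
Qed.

(** * Placements of blocks of prescribed lengths *)

(** Compared with [admissible], the interval is half-open, which avoids
predecessors when it is cut at the start of a block, and all pairs of blocks
are compared, so that the condition is inherited by sub-families; the latter
is what makes induction on the number of blocks work. *)
Definition blocks_in (a c p : nat) (i l : 'I_p -> nat) : bool :=
  [&& [forall t, (a <= i t)%N],
      [forall t : 'I_p, forall t' : 'I_p, (t < t')%N ==> (i t + l t <= i t')%N]
    & [forall t, (i t + l t <= c)%N]].

Definition block_weight (a c p : nat) (i l : 'I_p -> nat) : {poly int} :=
  (\prod_(a <= x < c | [forall t, ~~ (i t <= x < i t + l t)%N]) (1 - 'X^x))
  * \prod_(t < p) (- 'X^(i t)).

Lemma eq_blocks_in a c p (i i' l l' : 'I_p -> nat) : i =1 i' -> l =1 l' ->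
  blocks_in a c i l = blocks_in a c i' l'.
Proof.
move=> ei el; rewrite /blocks_in; congr [&& _, _ & _].
- by apply: eq_forallb => t; rewrite ei.
- by apply: eq_forallb => t; apply: eq_forallb => t'; rewrite !ei el.
by apply: eq_forallb => t; rewrite ei el.
Qed.

Lemma eq_block_weight a c p (i i' l l' : 'I_p -> nat) : i =1 i' -> l =1 l' ->
  block_weight a c i l = block_weight a c i' l'.
Proof.
move=> ei el; congr (_ * _); last by apply: eq_bigr => t _; rewrite ei.
by apply: eq_bigl => x; apply: eq_forallb => t; rewrite ei el.
Qed.

(** The condition on consecutive blocks propagates to all pairs, and those on
the first and the last block to all blocks, along the chain of blocks. *)
Lemma admissibleE a b p (i l : 'I_p -> nat) : (forall t, 0 < l t)%N ->
  admissible a b i l = blocks_in a b.+1 i l.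
Proof.
move=> l0; apply/and3P/and3P => -[/forallP ha /forallP hs /forallP hb]; last first.
  split; apply/forallP => t; [by apply/implyP| |apply/implyP => _].
  - by apply/forallP => t'; apply/implyP => e; have /forallP/(_ t')/implyP := hs t; apply; lia.
  - by have := hb t; have := l0 t; lia.
have step (t t' : 'I_p) : t' = t.+1 :> nat -> (i t + l t <= i t')%N.
  by move=> e; have /forallP/(_ t')/implyP := hs t; apply; apply/eqP.
(* n.+1 is the distance between the two blocks, so the induction starts at neighbours. *)
have chain n (t t' : 'I_p) : t' = (t + n.+1)%N :> nat -> (i t + l t <= i t')%N.
  elim: n t' => [|n IHn] t' e; first by apply: step; lia.
  have lt_t1 : (t + n.+1 < p)%N by have := ltn_ord t'; lia.
  have h1 := IHn (Ordinal lt_t1) erefl.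
  have h2 : (i (Ordinal lt_t1) + l (Ordinal lt_t1) <= i t')%N by apply: step => /=; lia.
  by lia.
have mono (t t' : 'I_p) : (t < t')%N -> (i t + l t <= i t')%N.
  by move=> tt'; apply: (chain (t' - t.+1)%N); lia.
split; apply/forallP => t.
- have p0 : (0 < p)%N by have := ltn_ord t; lia.
  have := ha (Ordinal p0); rewrite /= => a0.
  have [t0|t0] := posnP t; last by have := mono (Ordinal p0) t t0; lia.
  by rewrite (_ : t = Ordinal p0) //; apply: val_inj.
- by apply/forallP => t'; apply/implyP; apply: mono.
have p1 : (p.-1 < p)%N by have := ltn_ord t; lia.
have := hb (Ordinal p1); rewrite /= prednK ?eqxx /= => [hl|]; last by lia.
have [tl|tl] := eqVneq t (Ordinal p1); first by rewrite tl; have := l0 (Ordinal p1); lia.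
have lt_tl : (t < p.-1)%N.
  by have := ltn_ord t; move: tl; rewrite -val_eqE /=; lia.
by have := mono t (Ordinal p1) lt_tl; lia.
Qed.

(** The other blocks end at or before the start of the last one: cutting the
interval there decouples them from it. *)
Lemma blocks_in_recr a c p (i l : 'I_p.+1 -> nat) :
  blocks_in a c i l =
  blocks_in a (i ord_max) (i \o lift ord_max) (l \o lift ord_max)
  && (a <= i ord_max)%N && (i ord_max + l ord_max <= c)%N.
Proof.
apply/and3P/andP => [[/forallP ha /forallP hs /forallP hc]|[]].
  split; last exact: hc.
  rewrite ha andbT; apply/and3P; split; apply/forallP => t /=; first exact: ha.
    apply/forallP => t'; apply/implyP => tt'.
    by have /forallP/(_ (lift ord_max t'))/implyP := hs (lift ord_max t); apply; rewrite !lift_max.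
  have /forallP/(_ ord_max)/implyP := hs (lift ord_max t); apply.
  by rewrite lift_max /=.
case/andP=> /and3P[/forallP ha /forallP hs /forallP hc] am mc.
split; apply/forallP => t.
- by case: (unliftP ord_max t) => [s|] -> //; apply: ha.
- apply/forallP => t'; apply/implyP.
  case: (unliftP ord_max t) => [s|] ->; last by rewrite /= ltnNge -ltnS ltn_ord.
  case: (unliftP ord_max t') => [s'|] ->; last by move=> _; apply: hc.
  by rewrite !lift_max; have /forallP/(_ s')/implyP := hs s; apply.
case: (unliftP ord_max t) => [s|] -> //; have := hc s => /=; lia.
Qed.

(** The last block, starting at M and of length L, cuts [a,c) into [a,M), where
only the other blocks matter, [M,M+L), which is covered, and [M+L,c), which is
uncovered. *)
Lemma block_weight_recr a c p (i l : 'I_p.+1 -> nat) : blocks_in a c i l ->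
  block_weight a c i l =
  block_weight a (i ord_max) (i \o lift ord_max) (l \o lift ord_max)
  * - 'X^(i ord_max) * \prod_(i ord_max + l ord_max <= x < c) (1 - 'X^x).
Proof.
rewrite blocks_in_recr => /andP[/andP[/and3P[_ _ /forallP hc] am] mc].
rewrite /block_weight big_ord_recr /=.
have below s x : (x < i (lift ord_max s) + l (lift ord_max s) -> x < i ord_max)%N.
  by have := hc s => /=; lia.
rewrite (big_cat_nat (n := i ord_max)) //=; last by lia.
rewrite (big_cat_nat (n := i ord_max + l ord_max) (m := i ord_max)) //=; last by lia.
have -> : \prod_(i ord_max <= x < i ord_max + l ord_max |
      [forall t, ~~ (i t <= x < i t + l t)%N]) (1 - 'X^x) = 1 :> {poly int}.
  rewrite big_nat_cond big_pred0 // => x.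
  by apply/negP => /andP[hx /forallP/(_ ord_max)]; rewrite hx.
have -> : \prod_(a <= x < i ord_max | [forall t, ~~ (i t <= x < i t + l t)%N])
      (1 - 'X^x) = \prod_(a <= x < i ord_max | [forall t : 'I_p,
      ~~ (i (lift ord_max t) <= x < i (lift ord_max t) + l (lift ord_max t))%N])
      (1 - 'X^x) :> {poly int}.
  rewrite big_nat_cond [RHS]big_nat_cond; apply: eq_bigl => x.
  case: (boolP (a <= x < i ord_max)%N) => //= /andP[_ xm].
  apply/forallP/forallP => h t; first exact: (h (lift ord_max t)).
  case: (unliftP ord_max t) => [s|] -> //.
  by rewrite leqNgt xm.
have -> : \prod_(i ord_max + l ord_max <= x < c |
      [forall t, ~~ (i t <= x < i t + l t)%N]) (1 - 'X^x) =
    \prod_(i ord_max + l ord_max <= x < c) (1 - 'X^x) :> {poly int}.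
  rewrite big_nat_cond [RHS]big_nat_cond; apply: eq_bigl => x.
  case: (boolP (i ord_max + l ord_max <= x < c)%N) => //= /andP[xm _].
  apply/forallP => t; apply/negP => /andP[_].
  by case: (unliftP ord_max t) => [s|] -> => [/below|]; lia.
have -> : \prod_(t < p) - 'X^(i (widen_ord (leqnSn p) t)) =
    \prod_(t < p) - 'X^(i (lift ord_max t)) :> {poly int}.
  by apply: eq_bigr => t _; congr (- 'X^(i _)); apply: val_inj; rewrite /= /bump leqNgt ltn_ord.
by ring.
Qed.

(** The bound N on the starting points only makes the sum finite; it is kept apart
from c so that it does not change when the interval is cut. *)
Definition block_sum (N a c p : nat) (l : 'I_p -> nat) : {poly int} :=
  \sum_(i : {ffun 'I_p -> 'I_N} | blocks_in a c (fun t => i t) l)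
     block_weight a c (fun t => i t) l.

Lemma eq_block_sum N a c p (l l' : 'I_p -> nat) : l =1 l' ->
  block_sum N a c l = block_sum N a c l'.
Proof.
move=> el; apply: eq_big => [i|i _]; first exact: eq_blocks_in.
exact: eq_block_weight.
Qed.

Lemma SigmaPiE a b p (l : 'I_p -> nat) : (forall t, 0 < l t)%N ->
  SigmaPi a b l = block_sum b.+1 a b.+1 l.
Proof. by move=> l0; apply: eq_bigl => i; apply: admissibleE. Qed.

(** Sum over the starting point x of the last block, the other blocks being placed
freely in [a,x). *)
Lemma block_sum_recr N a c p (l : 'I_p.+1 -> nat) :
    (0 < l ord_max)%N -> (c <= N)%N ->
  block_sum N a c l =
  \sum_(a <= x < c.+1 - l ord_max) block_sum N a x (l \o lift ord_max)
     * - 'X^x * \prod_(x + l ord_max <= t < c) (1 - 'X^t).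
Proof.
move=> l0 cN; rewrite /block_sum sum_ffun_recr.
rewrite (big_nat_widen_ord (N := N)); last by lia.
apply: eq_bigr => x _.
have inE (g : {ffun 'I_p -> 'I_N}) :
    blocks_in a c (fun t => ffun_rcons g x t) l =
    blocks_in a x (fun t => g t) (l \o lift ord_max)
      && ((a <= x) && (x + l ord_max <= c))%N.
  rewrite blocks_in_recr ffun_rcons_max -andbA; congr (_ && _).
  by apply: eq_blocks_in => t //=; rewrite ffun_rcons_lift.
have -> : ((a <= x) && (x < c.+1 - l ord_max))%N =
    ((a <= x) && (x + l ord_max <= c))%N by lia.
case: ifP => ax; last by rewrite big_pred0 // => g; rewrite inE ax andbF.
rewrite !mulr_suml; apply: eq_big => [g|g]; first by rewrite inE ax andbT.
move=> gin; rewrite (block_weight_recr gin) ffun_rcons_max.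
congr (_ * _ * _); apply: eq_block_weight => t //=.
by rewrite ffun_rcons_lift.
Qed.

(** * Placements of blocks of prescribed total excess *)

(** The sum over the placements in [a,c) of u blocks with lengths at least 2 and
total excess m, organised by the last block: e + 1 is its excess, so e + 2 its
length, and x its start. *)
Fixpoint excess_sum (a u c m : nat) : {poly int} :=
  if u is u'.+1 then
    \sum_(e < m) \sum_(a <= x < c - e.+1)
      excess_sum a u' x (m - e.+1) * - 'X^x * \prod_(x + e.+2 <= t < c) (1 - 'X^t)
  else if m == 0%N then \prod_(a <= t < c) (1 - 'X^t) else 0.

(** Sorting the tuples d by their last entry, and the placements by the start of
their last block, yields the recursion of [excess_sum].  The bounds N and M of
the index types disappear, which makes different intervals and excesses
comparable. *)
Lemma sum_block_sum N M a u c m : (c <= N)%N -> (m <= M)%N ->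
  \sum_(d : {ffun 'I_u -> 'I_M.+1}
        | [forall r, 0 < d r]%N && (\sum_r d r == m)%N)
     block_sum N a c (fun r => (d r).+1) = excess_sum a u c m.
Proof.
elim: u c m => [|u IHu] c m cN mM /=.
  rewrite (sum_ffun_ord0 (v := \prod_(a <= t < c) (1 - 'X^t)) (p := m == 0%N)) //.
    move=> d; rewrite big_ord0 eq_sym andb_idl // => _.
    by apply/forallP => -[].
  move=> d; rewrite /block_sum.
  rewrite (sum_ffun_ord0 (v := \prod_(a <= t < c) (1 - 'X^t)) (p := true)) //.
    by move=> i; apply/and3P; split; apply/forallP => -[].
  move=> i; rewrite /block_weight big_ord0 mulr1; apply: eq_bigl => x.
  by apply/forallP => -[].
(* The last entry cannot be 0; the others are written e + 1. *)
rewrite sum_ffun_recr big_ord_recl /= [X in X + _]big_pred0 ?add0r => [|d]; last first.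
  by apply/negP => /andP[/forallP/(_ ord_max)]; rewrite ffun_rcons_max.
rewrite (big_ord_widen _ (fun e => \sum_(a <= x < c - e.+1)
   excess_sum a u x (m - e.+1) * - 'X^x * \prod_(x + e.+2 <= t < c) (1 - 'X^t)) mM).
rewrite [RHS]big_mkcond; apply: eq_bigr => e _.
have PE (d : {ffun 'I_u -> 'I_M.+1}) :
    [forall r, 0 < ffun_rcons d (lift ord0 e) r]%N
      && (\sum_r ffun_rcons d (lift ord0 e) r == m)%N =
    (e < m)%N && ([forall r, 0 < d r]%N && (\sum_r d r == m - e.+1)%N).
  rewrite big_ord_recr /= ffun_rcons_max /= /bump leq0n add1n.
  have -> : (\sum_(r < u) ffun_rcons d (lift ord0 e) (widen_ord (leqnSn u) r) =
      \sum_r d r)%N.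
    apply: eq_bigr => r _; congr (nat_of_ord _).
    rewrite -[in RHS](ffun_rcons_lift d (lift ord0 e)); congr (ffun_rcons _ _ _).
    by apply: val_inj; rewrite /= /bump leqNgt ltn_ord.
  have -> : [forall r, 0 < ffun_rcons d (lift ord0 e) r]%N = [forall r, 0 < d r]%N.
    apply/forallP/forallP => h r.
      by have := h (lift ord_max r); rewrite ffun_rcons_lift.
    case: (unliftP ord_max r) => [s|] ->; first by rewrite ffun_rcons_lift.
    by rewrite ffun_rcons_max.
  by case: [forall r, _] => /=; lia.
case: ifP => em; last by rewrite big_pred0 // => d; rewrite PE em.
rewrite (eq_bigl _ _ PE) em /=.
under eq_bigr => d _ do rewrite block_sum_recr // ffun_rcons_max /= subSS.
rewrite exchange_big /=; apply: eq_big_nat => x hx.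
rewrite -IHu; [|lia|lia]; rewrite !mulr_suml; apply: eq_bigr => d _.
rewrite /bump leq0n add1n; congr (_ * _ * _); apply: eq_block_sum => r /=.
by rewrite ffun_rcons_lift.
Qed.

(** Each block has excess at least 1. *)
Lemma excess_sum_gt_excess a u c m : (m < u)%N -> excess_sum a u c m = 0.
Proof.
elim: u c m => //= u IHu c m mu.
rewrite big1 // => e _; rewrite big1_seq // => x _.
by rewrite IHu ?mul0r //; have := ltn_ord e; lia.
Qed.

(** The blocks cover m + u points, too many for [a,c).  Without any block the
sum is 0 as soon as a positive excess is asked for; the case u = m = 0 is
excluded because it gives the empty product 1 when c < a. *)
Lemma excess_sum_gt_length a u c m : (0 < u)%N || (0 < m)%N -> (c < m + u + a)%N ->
  excess_sum a u c m = 0.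
Proof.
case: u => [|u] um; first by move: um => /=; case: m.
elim: u c m {um} => [|u IHu] c m cmu /=; rewrite big1 // => e _;
  have em := ltn_ord e; rewrite big_nat big1 // => x hx.
  case: eqP => me; rewrite ?mul0r //; lia.
by have := IHu x (m - e.+1)%N; rewrite /= => ->; rewrite ?mul0r //; lia.
Qed.

(** The number u of blocks is free; it is at most their total excess m. *)
Definition block_total (a c m : nat) : {poly int} :=
  \sum_(u < m.+1) excess_sum a u c m.

Lemma block_totalE K a c m : (m < K)%N ->
  \sum_(u < K) excess_sum a u c m = block_total a c m.
Proof.
move=> mK; rewrite /block_total (big_ord_widen K (fun u => excess_sum a u c m) mK).
rewrite [RHS]big_mkcond; apply: eq_bigr => u _; case: ltnP => // mu.
by rewrite excess_sum_gt_excess.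
Qed.

Lemma block_total0 a c : block_total a c 0 = \prod_(a <= t < c) (1 - 'X^t).
Proof. by rewrite /block_total big_ord1. Qed.

(** At least one block is present, so at least m + 1 points would be covered. *)
Lemma block_total_short a c m : (0 < m)%N -> (c <= m + a)%N ->
  block_total a c m = 0.
Proof.
move=> m0 cm; rewrite /block_total big1 // => -[[|u] hu] _ /=.
  by case: m m0 {cm hu}.
by apply: (@excess_sum_gt_length a u.+1); lia.
Qed.

(** Summing over the number of blocks turns the recursion of [excess_sum] into one
that involves [block_total] alone. *)
Lemma block_total_recr a c m :
  block_total a c m =
  (if m == 0%N then \prod_(a <= t < c) (1 - 'X^t) else 0) +
  \sum_(e < m) \sum_(a <= x < c - e.+1) block_total a x (m - e.+1) * - 'X^x
     * \prod_(x + e.+2 <= t < c) (1 - 'X^t).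
Proof.
rewrite /block_total big_ord_recl; congr (_ + _).
under eq_bigr => u _ do rewrite lift0 /=.
rewrite exchange_big; apply: eq_bigr => e _ /=.
rewrite exchange_big; apply: eq_bigr => x _ /=.
rewrite -!mulr_suml block_totalE //; have := ltn_ord e; lia.
Qed.

(** * The three-term recurrence *)

(** Either c is uncovered, or a block of excess e + 1 ends at c; it then starts at
c - (e + 1), which must be at least a. *)
Lemma block_total_step a c m : (a <= c)%N ->
  block_total a c.+1 m =
  (1 - 'X^c) * block_total a c m -
  \sum_(e < m) (if (a + e.+1 <= c)%N
     then block_total a (c - e.+1) (m - e.+1) * 'X^(c - e.+1) else 0).
Proof.
move=> ac; rewrite !block_total_recr mulrDr -addrA; congr (_ + _).
  by case: ifP => _; rewrite ?mulr0 // big_nat_recr //= mulrC.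
rewrite mulr_sumr -sumrB; apply: eq_bigr => e _; rewrite subSS.
have [ae|ae] := leqP (a + e.+1) c; last first.
  by rewrite !big_geq ?mulr0 ?subr0 //; lia.
(* The top starting point x = c - (e + 1) gives the block that ends at c. *)
rewrite (_ : c - e = (c - e.+1).+1)%N; last by lia.
rewrite big_nat_recr /=; last by lia.
rewrite [X in _ + _ * X]big_geq ?mulr1 ?mulrN; last by lia.
congr (_ - _); rewrite mulr_sumr; apply: eq_big_nat => x hx.
by rewrite big_nat_recr /=; [ring|lia].
Qed.

(** Lowering by 1 the interval, the total excess and the excess of the top block
leaves q^(c-e) S(c-e,m-e) unchanged: the sums of [block_total_step] for
(c+1,m+1) and (c,m) differ only by the term of a top block of length 2, which
is q^c S(c,m).  Together with the factor 1 - q^c of the second sum, this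
gives the coefficient - 1 of the last term. *)
Lemma block_total_three_term a c m : (a <= c)%N ->
  block_total a c.+2 m.+1 =
  block_total a c.+1 m + (1 - 'X^(c.+1)) * block_total a c.+1 m.+1
  - block_total a c m.
Proof.
move=> ac; rewrite block_total_step; last by lia.
rewrite big_ord_recl /= addn1 ltnS ac !subSS !subn0.
rewrite (block_total_step m ac).
rewrite (eq_bigr (fun e : 'I_m => if (a + e.+1 <= c)%N
     then block_total a (c - e.+1) (m - e.+1) * 'X^(c - e.+1) else 0)).
  by ring.
by move=> e _; rewrite /bump leq0n !add1n !subSS addnS ltnS.
Qed.

(** * The coefficients and the recurrence for the formula *)

(** The range of u in [bcoef] stops at min(j-k-1, k-t); for u > j-k-1 the blocks
do not fit into the interval, so the range may be extended to k-t. *)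
Lemma bcoefE j k t : (t <= k)%N -> (k <= j - 1)%N ->
  bcoef j k t = block_total t.+2 j.+1 (k - t).
Proof.
move=> tk kj; rewrite /bcoef; case: eqP => [->|/eqP tnk]; first by rewrite subnn block_total0.
have m0 : (0 < k - t)%N by lia.
rewrite /block_total big_ord_recl /= -[_ == 0%N]negbK -lt0n m0 add0r.
rewrite (eq_big_nat _ _ (F2 := fun u => excess_sum t.+2 u j.+1 (k - t))); last first.
  move=> u _; rewrite -(sum_block_sum _ _ (leqnn j.+1) (leqnn (k - t))).
  by apply: eq_bigr => d _; rewrite SigmaPiE.
rewrite [RHS](_ : _ = \sum_(1 <= u < (k - t).+1) excess_sum t.+2 u j.+1 (k - t)); last first.
  by rewrite big_add1 big_mkord.
rewrite [RHS](big_cat_nat (n := (minn (j - k - 1) (k - t)).+1)) //=; last by lia.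
rewrite [X in _ = _ + X]big_nat [X in _ = _ + X]big1 ?addr0 // => u hu.
by apply: excess_sum_gt_length; lia.
Qed.

Definition b_formula (j k : nat) : {poly int} :=
  \sum_(1 <= t < k.+1) (1 - psi t) * block_total t.+2 j.+1 (k - t).

(** The interval t+2, ..., j has only j-1-t points, the excess to be realised
when k = j-1; no block fits, so only t = k contributes. *)
Lemma b_formula_subdiag j : (2 <= j)%N -> b_formula j j.-1 = 1 - psi j.-1.
Proof.
case: j => [|[|j]] //= _; rewrite /b_formula big_nat_recr //= subnn block_total0.
rewrite [X in _ + _ * X]big_geq // mulr1 big_nat big1 ?add0r // => t ht.
by rewrite block_total_short ?mulr0 //; lia.
Qed.

(** The three-term recurrence, summed over t < k; the term t = k occurs only in the
two sums with upper index k, where it is a product gaining the factor 1 - q^j. *)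
Lemma b_formula_rec j k : (0 < k)%N -> (k.+2 <= j)%N ->
  b_formula j k = b_formula j.-1 k.-1 + (1 - 'X^j) * b_formula j.-1 k
                  - b_formula j.-2 k.-1.
Proof.
case: k => [|k] //; case: j => [|[|j]] //= _ kj.
rewrite /b_formula [LHS]big_nat_recr //= [X in _ + _ * X - _]big_nat_recr //=.
rewrite subnn !block_total0 (@big_nat_recr _ _ _ j.+2 k.+3) /=; last by lia.
rewrite (eq_big_nat _ _ (F2 := fun t =>
  (1 - psi t) * block_total t.+2 j.+2 (k - t)
  + (1 - 'X^(j.+2)) * ((1 - psi t) * block_total t.+2 j.+2 (k.+1 - t))
  - (1 - psi t) * block_total t.+2 j.+1 (k - t))); last first.
  move=> t ht; rewrite subSn; last by lia.
  by rewrite block_total_three_term; [ring|lia].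
rewrite sumrB big_split /= -mulr_sumr.
by ring.
Qed.

Unset Implicit Arguments.

Theorem theorem3p3 (b : nat -> nat -> {poly int}) (hb : is_b_family b)
    (j k : nat) (hjk : (1 <= k <= j - 1)%N) :
  b j k = \sum_(1 <= t < k.+1) (1 - psi t) * bcoef j k t.
Proof.
pose c j k : {poly int} := if k == j then 1 else b_formula j k.
have hc : is_b_family c.
  split=> [i _|i i2|i l /andP[l2 li]].
  - by rewrite /c eqxx.
  - rewrite /c ifN; last by lia.
    rewrite /b_formula big_nat1 subnn block_total0 /psi big_nat1.
    by rewrite [RHS]big_ltn //; lia.
  have [ltli|geli] := ltnP l.+1 i.
    rewrite /c !ifN; try lia.
    by rewrite b_formula_rec ?(ltnW l2) // !subn1 subn2.
  (* Here l = i - 1, so two of the three preceding values lie on the diagonal. *)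
  have i3 : (3 <= i)%N by lia.
  have {geli li l2} -> : l = i.-1 by lia.
  case: i i3 => [|[|[|i]]] //.
  move=> _; rewrite /c !subn1 subn2 /= !eqxx !ifN; try lia.
  rewrite (@b_formula_subdiag i.+3) // (@b_formula_subdiag i.+2) //=.
  by rewrite {1}/psi big_nat_recr //= -/(psi i.+1); ring.
have -> : b j k = c j k by apply: (b_family_unique hb hc); lia.
rewrite /c ifN; last by lia.
by apply: eq_big_nat => t ht; rewrite bcoefE //; lia.
Qed.
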